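(* Let $\mathfrak g$ be a finite-dimensional complex simple Lie algebra and $L(\mathfrak g)=\mathfrak g\otimes\mathbb C[t,t^{-1}]$. Every indecomposable finite-dimensional $L(\mathfrak g)$-module has a spectral character; that is, for every indecomposable finite-dimensional $L(\mathfrak g)$-module $V$ there exists $\chi\in\Xi$ such that $\chi_{\boldsymbol\pi}=\chi$ for every irreducible constituent $V(\boldsymbol\pi)$ of $V$.
   Context: Fix a Cartan subalgebra $\mathfrak h$ of $\mathfrak g$, simple roots $\alpha_i$, fundamental weights $\omega_i$ and simple coroots $h_i$, $i\in I=\{1,\dots,n\}$. $P$ is the weight lattice, $Q$ the root lattice, $P^+$ the set of dominant integral weights, $\Gamma=P/Q$, and $\overline\lambda$ is the image of $\lambda\in P$ in $\Gamma$. For $\lambda\in P^+$, $V(\lambda)$ is the irreducible $\mathfrak g$-module of highest weight $\lambda$. The bracket on $L(\mathfrak g)$ is $[x\otimes f,y\otimes g]=[x,y]\otimes fg$. Irreducible modules: $\mathcal P$ is the monoid (under coordinatewise multiplication) of $n$-tuples of polynomials in $\mathbb C[u]$ with constant term $1$. For $\lambda\in P^+$, $a\in\mathbb C^\times$, $\boldsymbol\pi_{\lambda,a}\in\mathcal P$ has $i$-th coordinate $(1-au)^{\lambda(h_i)}$. Every $\boldsymbol\pi\in\mathcal P$ is uniquely (up to order) a product $\boldsymbol\pi=\prod_{j=1}^r\boldsymbol\pi_{\lambda_j,a_j}$ with distinct $a_j\in\mathbb C^\times$ and nonzero $\lambda_j\in P^+$. $V(\boldsymbol\pi_{\lambda,a})$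 is the pull-back of $V(\lambda)$ along the evaluation homomorphism $L(\mathfrak g)\to\mathfrak g$, $x\otimes t^k\mapsto a^kx$, and $V(\boldsymbol\pi)=\bigotimes_{j}V(\boldsymbol\pi_{\lambda_j,a_j})$. The map $\boldsymbol\pi\mapsto V(\boldsymbol\pi)$ is a bijection from $\mathcal P$ to the isomorphism classes of irreducible finite-dimensional $L(\mathfrak g)$-modules. Spectral characters: $\Xi$ is the additive group of functions $\chi:\mathbb C^\times\to\Gamma$ with finite support. $\chi_{\lambda,a}\in\Xi$ takes the value $\overline\lambda$ at $a$ and $0$ elsewhere; for $\boldsymbol\pi=\prod_{j=1}^r\boldsymbol\pi_{\lambda_j,a_j}$ with distinct $a_j\in\mathbb C^\times$ and nonzero $\lambda_j\in P^+$, $\chi_{\boldsymbol\pi}=\sum_j\chi_{\lambda_j,a_j}$. Irreducible constituents are the Jordan–Hölder constituents. *)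

(* Defs.v *)
From HB Require Import structures.
From mathcomp Require Import all_boot all_order all_algebra.
From mathcomp Require Import finmap monalg complex.
From mathcomp Require Import boolp classical_sets reals.

Set Implicit Arguments.
Unset Strict Implicit.
Unset Printing Implicit Defensive.
Import GRing.Theory.
Local Open Scope ring_scope.

HB.mixin Record Lmodule_isLieAlgebra (F : fieldType) L of GRing.Lmodule F L := {
  lie : L -> L -> L;
  lie_linearl : forall y, linear (lie^~ y);
  lie_linearr : forall x, linear (lie x);
  liexx : forall x, lie x x = 0;
  lie_jacobi : forall x y z, lie x (lie y z) + lie y (lie z x) + lie z (lie x y) = 0
}.

#[short(type="lieAlgType")]
HB.structure Definition LieAlgebra (F : fieldType) :=
  { L of GRing.Lmodule F L & Lmodule_isLieAlgebra F L }.

#[short(type="finLieAlgType")]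
HB.structure Definition FinLieAlgebra (F : fieldType) :=
  { L of LieAlgebra F L & Vector F L }.

Section LieTheory.
Variables (F : fieldType) (g : lieAlgType F).
Implicit Types x y z : g.

HB.instance Definition _ x :=
  GRing.isLinear.Build F g g *:%R (lie x) (lie_linearr x).

Definition lier y x := lie x y.
HB.instance Definition _ y :=
  GRing.isLinear.Build F g g *:%R (lier y) (lie_linearl y).

Lemma lieC x y : lie x y = - lie y x.
Proof.
apply/eqP; rewrite -addr_eq0; apply/eqP.
have := liexx (x + y); rewrite linearD /= -[lie _ x]/(lier x _) -[lie _ y]/(lier y _).
by rewrite !linearD /= /lier !liexx add0r addr0 addrC.
Qed.

End LieTheory.

Definition simple_lie (F : fieldType) (g : finLieAlgType F) : Prop :=
  (exists x y : g, lie x y <> 0) /\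
  (forall J : {vspace g}, (forall x y : g, y \in J -> lie x y \in J) ->
     J = 0%VS \/ J = fullv).

(* [{malg g[int]}] is the group of finitely supported functions [int -> g];
   [<< x *g k >>] stands for [x (x) t^k], so that this is g (x) F[t, t^-1]. *)
Definition loop (F : fieldType) (g : lieAlgType F) : Type := {malg g[int]}.

Section Loop.
Variables (F : fieldType) (g : lieAlgType F).
Local Notation L := (loop g).
Implicit Types X Y Z : L.

HB.instance Definition _ := GRing.Zmodule.on L.

Definition loop_scale (c : F) X : L := \sum_(k <- msupp X) << c *: X@_k *g k >>.

Lemma loop_scaleE c X k : (loop_scale c X)@_k = c *: X@_k.
Proof.
rewrite [in RHS](monalgE X) /loop_scale (raddf_sum (mcoeff k)).
rewrite (raddf_sum (mcoeff k)) scaler_sumr.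
by apply: eq_bigr => i _ /=; rewrite !mcoeffU scalerMnr.
Qed.

Lemma loop_scaleA a b X : loop_scale a (loop_scale b X) = loop_scale (a * b) X.
Proof. by apply/malgP => k; rewrite !loop_scaleE scalerA. Qed.
Lemma loop_scale1 : left_id 1 loop_scale.
Proof. by move=> X; apply/malgP => k; rewrite loop_scaleE scale1r. Qed.
Lemma loop_scaleDr : right_distributive loop_scale +%R.
Proof.
by move=> a X Y; apply/malgP => k; rewrite !(loop_scaleE, mcoeffD) scalerDr.
Qed.
Lemma loop_scaleDl X : {morph loop_scale^~ X : a b / a + b}.
Proof. by move=> a b; apply/malgP => k; rewrite !(loop_scaleE, mcoeffD) scalerDl. Qed.

HB.instance Definition _ := GRing.Zmodule_isLmodule.Build F L
  loop_scaleA loop_scale1 loop_scaleDr loop_scaleDl.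

Definition loop_lie X Y : L :=
  \sum_(k <- msupp X) \sum_(l <- msupp Y) << lie X@_k Y@_l *g k + l >>.

Lemma lie0x (x : g) : lie 0 x = 0.
Proof. exact: (linear0 (lier x)). Qed.

Lemma loop_lieEw (d1 d2 : {fset int}) X Y :
  (msupp X `<=` d1)%fset -> (msupp Y `<=` d2)%fset ->
  loop_lie X Y = \sum_(k <- d1) \sum_(l <- d2) << lie X@_k Y@_l *g k + l >>.
Proof.
move=> s1 s2; rewrite /loop_lie (big_fset_incl _ s1) /=; last first.
  by move=> k _ /mcoeff_outdom ->; rewrite big1 // => l _; rewrite lie0x monalgU0.
apply: eq_bigr => k _; apply: big_fset_incl => // l _ /mcoeff_outdom ->.
by rewrite linear0 monalgU0.
Qed.

Lemma monalgUZ (c : F) (x : g) k : << c *: x *g k >> = c *: (<< x *g k >> : L).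
Proof. by apply/malgP => l; rewrite loop_scaleE !mcoeffU scalerMnr. Qed.

Lemma loop_lie_linearl Y : linear (loop_lie^~ Y).
Proof.
move=> c X1 X2.
pose d : {fset int} := (msupp (c *: X1 + X2)%R `|` (msupp X1 `|` msupp X2))%fset.
rewrite !(@loop_lieEw d (msupp Y)) //.
- rewrite scaler_sumr -big_split /=; apply: eq_bigr => k _.
  rewrite scaler_sumr -big_split /=; apply: eq_bigr => l _.
  by rewrite mcoeffD loop_scaleE lie_linearl monalgUD monalgUZ.
- by apply: fsubset_trans (fsubsetUr _ _); apply: fsubsetUr.
- by apply: fsubset_trans (fsubsetUr _ _); apply: fsubsetUl.
- exact: fsubsetUl.
Qed.

Lemma loop_lie_linearr X : linear (loop_lie X).
Proof.
move=> c Y1 Y2.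
pose d : {fset int} := (msupp (c *: Y1 + Y2)%R `|` (msupp Y1 `|` msupp Y2))%fset.
rewrite !(@loop_lieEw (msupp X) d) //.
- rewrite scaler_sumr -big_split /=; apply: eq_bigr => k _.
  rewrite scaler_sumr -big_split /=; apply: eq_bigr => l _.
  by rewrite mcoeffD loop_scaleE lie_linearr monalgUD monalgUZ.
- by apply: fsubset_trans (fsubsetUr _ _); apply: fsubsetUr.
- by apply: fsubset_trans (fsubsetUr _ _); apply: fsubsetUl.
- exact: fsubsetUl.
Qed.

Lemma loop_lieU (x y : g) k l :
  loop_lie << x *g k >> << y *g l >> = << lie x y *g k + l >>.
Proof.
rewrite (@loop_lieEw [fset k]%fset [fset l]%fset) ?msuppU_le //.
by rewrite !big_seq_fset1 !mcoeffUU.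
Qed.

HB.instance Definition _ X :=
  GRing.isLinear.Build F L L *:%R (loop_lie X) (loop_lie_linearr X).

Definition loop_lier Y X := loop_lie X Y.
HB.instance Definition _ Y :=
  GRing.isLinear.Build F L L *:%R (loop_lier Y) (loop_lie_linearl Y).

Lemma loop_lie_sum X Y :
  loop_lie X Y = \sum_(k <- msupp X) \sum_(l <- msupp Y)
    loop_lie << X@_k *g k >> << Y@_l *g l >>.
Proof. by apply: eq_bigr => k _; apply: eq_bigr => l _; rewrite loop_lieU. Qed.

Lemma loop_ind (P : L -> Prop) : P 0 -> (forall X Y, P X -> P Y -> P (X + Y)) ->
  (forall x k, P << x *g k >>) -> forall X, P X.
Proof. by move=> P0 PD PU X; rewrite [X]monalgE; apply: big_ind. Qed.

Lemma loop_lieDl X Y Z : loop_lie (X + Y) Z = loop_lie X Z + loop_lie Y Z.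
Proof. exact: (linearD (loop_lier Z)). Qed.

Lemma loop_lie0l Z : loop_lie 0 Z = 0.
Proof. exact: (linear0 (loop_lier Z)). Qed.

Lemma loop_lieDr X Y Z : loop_lie X (Y + Z) = loop_lie X Y + loop_lie X Z.
Proof. exact: linearD. Qed.

Lemma loop_lie0r X : loop_lie X 0 = 0.
Proof. exact: linear0. Qed.

Lemma loop_lieC X Y : loop_lie X Y = - loop_lie Y X.
Proof.
elim/loop_ind: X => [|X X' IH IH'|x k]; first by rewrite loop_lie0r loop_lie0l oppr0.
  by rewrite loop_lieDr loop_lieDl IH IH' opprD.
elim/loop_ind: Y => [|Y Y' IH IH'|y l]; first by rewrite loop_lie0r loop_lie0l oppr0.
  by rewrite loop_lieDr loop_lieDl IH IH' opprD.
by rewrite !loop_lieU lieC monalgUN addrC.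
Qed.

Lemma loop_liexx X : loop_lie X X = 0.
Proof.
elim/loop_ind: X => [|X Y IHX IHY|x k]; first exact: linear0.
  by rewrite loop_lieDr !loop_lieDl IHX IHY add0r addr0 loop_lieC addNr.
by rewrite loop_lieU liexx monalgU0.
Qed.

Lemma loop_jacobi X Y Z : loop_lie X (loop_lie Y Z) + loop_lie Y (loop_lie Z X) +
  loop_lie Z (loop_lie X Y) = 0.
Proof.
have add3 (a a' b b' c c' : L) : a + b + c = 0 -> a' + b' + c' = 0 ->
    (a + a') + (b + b') + (c + c') = 0.
  by move=> e e'; rewrite (addrACA a) (addrACA (a + b)) e e' addr0.
elim/loop_ind: X => [|X X' IH IH'|x k].
- by rewrite !(loop_lie0l, loop_lie0r) !addr0.
- by rewrite !(loop_lieDl, loop_lieDr) add3.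
elim/loop_ind: Y => [|Y Y' IH IH'|y l].
- by rewrite !(loop_lie0l, loop_lie0r) !addr0.
- by rewrite !(loop_lieDl, loop_lieDr) add3.
elim/loop_ind: Z => [|Z Z' IH IH'|z m].
- by rewrite !(loop_lie0l, loop_lie0r) !addr0.
- by rewrite !(loop_lieDl, loop_lieDr) add3.
have e1 : l + (m + k) = k + (l + m) by rewrite addrA addrC.
have e2 : m + (k + l) = k + (l + m) by rewrite addrC addrA.
by rewrite !loop_lieU e1 e2 -!monalgUD lie_jacobi monalgU0.
Qed.

HB.instance Definition _ := Lmodule_isLieAlgebra.Build F L
  loop_lie_linearl loop_lie_linearr loop_liexx loop_jacobi.

Lemma loop_lieE (x y : g) (k l : int) :
  lie (<< x *g k >> : L) << y *g l >> = << lie x y *g k + l >>.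
Proof. exact: loop_lieU. Qed.

(* Evaluation at t = a, i.e. x (x) t^k |-> a^k x, with [k : int]. *)
Definition loop_eval (a : F) X : g := \sum_(k <- msupp X) (a ^ k) *: X@_k.

Lemma loop_evalEw (a : F) (d : {fset int}) X : (msupp X `<=` d)%fset ->
  loop_eval a X = \sum_(k <- d) (a ^ k) *: X@_k.
Proof.
by move=> sX; apply: big_fset_incl => // k _ /mcoeff_outdom ->; rewrite scaler0.
Qed.

Lemma loop_eval_linear (a : F) : linear (loop_eval a).
Proof.
move=> c X Y.
pose d : {fset int} := (msupp (c *: X + Y)%R `|` (msupp X `|` msupp Y))%fset.
rewrite !(@loop_evalEw a d).
- rewrite scaler_sumr -big_split /=; apply: eq_bigr => k _.
  by rewrite mcoeffD loop_scaleE scalerDr !scalerA mulrC.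
- by apply: fsubset_trans (fsubsetUr _ _); apply: fsubsetUr.
- by apply: fsubset_trans (fsubsetUr _ _); apply: fsubsetUl.
- exact: fsubsetUl.
Qed.

HB.instance Definition _ (a : F) :=
  GRing.isLinear.Build F L g *:%R (loop_eval a) (@loop_eval_linear a).

Lemma loop_evalU (a : F) (x : g) k : loop_eval a << x *g k >> = (a ^ k) *: x.
Proof.
rewrite (@loop_evalEw a [fset k]%fset) ?msuppU_le //.
by rewrite big_seq_fset1 mcoeffUU.
Qed.

Lemma loop_eval_lie (a : F) X Y : a != 0 ->
  loop_eval a (lie X Y) = lie (loop_eval a X) (loop_eval a Y).
Proof.
move=> a0; have lie0l (y : g) : lie 0 y = 0 by exact: (linear0 (lier y)).
have lieDl (u v y : g) : lie (u + v) y = lie u y + lie v y.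
  exact: (linearD (lier y)).
have lieZl c (u y : g) : lie (c *: u) y = c *: lie u y by exact: (linearZ_LR (lier y)).
rewrite -[lie X Y]/(loop_lie X Y).
elim/loop_ind: X => [|X X' IH IH'|x k]; first by rewrite loop_lie0l !linear0 lie0l.
  by rewrite loop_lieDl !linearD /= lieDl IH IH'.
elim/loop_ind: Y => [|Y Y' IH IH'|y l]; first by rewrite loop_lie0r !linear0.
  by rewrite loop_lieDr !linearD /= IH IH'.
by rewrite loop_lieU !loop_evalU lieZl linearZ scalerA expfzDr.
Qed.

End Loop.

Section Representations.
Variables (F : fieldType) (L : lieAlgType F) (V : vectType F).
Implicit Types (rho : L -> 'End(V)) (U W : {vspace V}).

Definition is_rep rho : Prop :=
  linear rho /\
  forall x y v, rho (lie x y) v = rho x (rho y v) - rho y (rho x v).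

Definition submodule rho U : Prop := forall x u, u \in U -> rho x u \in U.

Definition irreducible_rep rho : Prop :=
  fullv <> 0%VS :> {vspace V} /\
  forall U, submodule rho U -> U = 0%VS \/ U = fullv.

Definition indecomposable_rep rho : Prop :=
  fullv <> 0%VS :> {vspace V} /\
  forall U W, submodule rho U -> submodule rho W ->
    (U + W)%VS = fullv -> (U :&: W)%VS = 0%VS -> U = 0%VS \/ W = 0%VS.

(* For submodules U and W: U is contained in W and W / U is irreducible, the
   submodules of W / U being the X / U with U <= X <= W. *)
Definition irreducible_step rho U W : Prop :=
  [/\ (U <= W)%VS, U <> W &
   forall X, submodule rho X -> (U <= X <= W)%VS -> X = U \/ X = W].

Definition composition_series rho (m : nat) (W : nat -> {vspace V}) : Prop :=
  [/\ W 0 = 0%VS, W m = fullv,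
      forall i, (i <= m)%N -> submodule rho (W i) &
      forall i, (i < m)%N -> irreducible_step rho (W i) (W i.+1)].

(* W / U is isomorphic to M: [phi] restricts to a surjective morphism W -> M
   with kernel U (its values outside W are irrelevant). *)
Definition subquotient_iso rho U W (M : vectType F) (sigma : L -> 'End(M)) : Prop :=
  exists phi : 'Hom(V, M),
    [/\ (phi @: W)%VS = fullv, (W :&: lker phi)%VS = U &
        forall x w, w \in W -> phi (rho x w) = sigma x (phi w)].

Definition irreducible_constituent rho (M : vectType F) (sigma : L -> 'End(M)) : Prop :=
  exists m (W : nat -> {vspace V}), composition_series rho m W /\
    exists2 i, (i < m)%N & subquotient_iso rho (W i) (W i.+1) sigma.

End Representations.

Section Tensor.
Variables (F : fieldType) (r : nat) (W : 'I_r -> vectType F).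

Definition multilinear_map (U : vectType F) (f : (forall j, W j) -> U) : Prop :=
  forall (w : forall j, W j) (j : 'I_r), linear (fun x : W j => f (dfwith w x)).

Definition is_tensor_product (T : vectType F) (tau : (forall j, W j) -> T) : Prop :=
  multilinear_map tau /\
  forall (U : vectType F) (f : (forall j, W j) -> U), multilinear_map f ->
    exists! phi : 'Hom(T, U), forall w, phi (tau w) = f w.

Definition tensor_rep (L : lieAlgType F) (rho : forall j, L -> 'End(W j))
    (T : vectType F) (sigma : L -> 'End(T)) : Prop :=
  exists2 tau : (forall j, W j) -> T, is_tensor_product tau &
    forall x w, sigma x (tau w) = \sum_j tau (dfwith w (rho j x (w j))).

End Tensor.

Section Roots.
Variables (F : fieldType) (g : finLieAlgType F).
Implicit Types (h : {vspace g}).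

Definition ad_diagonalizable (x : g) : Prop :=
  exists2 b : seq g, basis_of fullv b &
    forall y, y \in b -> exists c : F, lie x y = c *: y.

(* In a semisimple Lie algebra: a maximal abelian subalgebra all of whose
   elements are ad-semisimple. *)
Definition is_cartan h : Prop :=
  [/\ forall x y, x \in h -> y \in h -> lie x y = 0,
      forall x, (forall y, y \in h -> lie x y = 0) -> x \in h &
      forall x, x \in h -> ad_diagonalizable x].

Definition dual h := 'Hom(subvs_of h, F^o).

Definition in_root_space h (b : dual h) (x : g) : Prop :=
  forall H : subvs_of h, lie (vsval H) x = (b H : F) *: x.

Definition is_root h (b : dual h) : Prop :=
  b <> 0 /\ exists2 x, x <> 0 & in_root_space b x.

Definition nonneg_comb h n (alpha : 'I_n -> dual h) (b : dual h) : Prop :=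
  exists c : 'I_n -> nat, b = \sum_i alpha i *+ c i.

Definition is_simple_system h n (alpha : 'I_n -> dual h) : Prop :=
  [/\ basis_of fullv [tuple alpha i | i < n],
      forall i, is_root (alpha i) &
      forall b, is_root b -> nonneg_comb alpha b \/ nonneg_comb alpha (- b)].

(* The coroot of b is the element of [g_b, g_{-b}] on which b takes the value 2. *)
Definition is_coroot h (b : dual h) (H : subvs_of h) : Prop :=
  b H = 2 /\
  exists e f, [/\ in_root_space b e, in_root_space (- b) f & lie e f = vsval H].

Record cartan_datum := CartanDatum {
  cartan : {vspace g};
  rank : nat;
  simple_root : 'I_rank -> dual cartan;
  simple_coroot : 'I_rank -> subvs_of cartan;
  cartanP : is_cartan cartan;
  simple_rootP : is_simple_system simple_root;
  simple_corootP : forall i, is_coroot (simple_root i) (simple_coroot i)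
}.

End Roots.

Arguments simple_root {F g} D i : rename.
Arguments simple_coroot {F g} D i : rename.

Section Weights.
Variables (F : fieldType) (g : finLieAlgType F) (D : cartan_datum g).

Definition integral_form : {pred dual (cartan D)} := fun l =>
  `[< forall i, exists z : int, l (simple_coroot D i) = z%:~R >].

Lemma integral_form_closed : zmod_closed integral_form.
Proof.
split=> [|l m /asboolP hl /asboolP hm]; apply/asboolP => i.
  by exists 0; rewrite lfunE.
have [[a ea] [b eb]] := (hl i, hm i).
by exists (a - b); rewrite !lfunE /= lfunE /= ea eb rmorphB.
Qed.

HB.instance Definition _ :=
  GRing.isZmodClosed.Build (dual (cartan D)) integral_form integral_form_closed.

Record weight := Weight {
  weight_form : dual (cartan D);
  weight_formP : weight_form \in integral_form
}.

HB.instance Definition _ := [isSub for weight_form].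
HB.instance Definition _ := [Choice of weight by <:].
HB.instance Definition _ := [SubChoice_isSubZmodule of weight by <:].

Lemma weight_ex (l : weight) i :
  exists z : int, weight_form l (simple_coroot D i) == z%:~R.
Proof. by have /asboolP/(_ i)[z ez] := weight_formP l; exists z; apply/eqP. Qed.

Definition pairing (l : weight) i : int := xchoose (weight_ex l i).

Lemma pairingE l i : weight_form l (simple_coroot D i) = (pairing l i)%:~R.
Proof. exact/eqP/(xchooseP (weight_ex l i)). Qed.

Definition dominant (l : weight) : Prop := forall i, (0 <= pairing l i)%R.

Definition root_lattice : {pred weight} := fun l =>
  `[< exists c : 'I_(rank D) -> int, weight_form l = \sum_i simple_root D i *~ c i >].

Lemma root_lattice_closed : zmod_closed root_lattice.
Proof.
split=> [|l m /asboolP[c ec] /asboolP[d ed]]; apply/asboolP.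
  by exists (fun=> 0); rewrite big1 // => i _; rewrite mulr0z.
exists (fun i => c i - d i); rewrite -[weight_form _]/(val (l - m)) raddfB /=.
by rewrite ec ed -sumrB; apply: eq_bigr => i _; rewrite mulrzBr.
Qed.

HB.instance Definition _ :=
  GRing.isZmodClosed.Build weight root_lattice root_lattice_closed.

(* Gamma = P / Q *)
Definition weight_class : Type := Quotient.quot root_lattice.
HB.instance Definition _ := GRing.Zmodule.on weight_class.

Definition class_of_weight (l : weight) : weight_class := \pi_(weight_class)%qT l.

(* The irreducible module V(l): the highest weight vector is killed by all
   positive root vectors. *)
Definition is_highest_weight_simple (l : weight) (M : vectType F)
    (rho : g -> 'End(M)) : Prop :=
  [/\ is_rep rho, irreducible_rep rho &
   exists v : M, [/\ v <> 0,
     forall H : subvs_of (cartan D), rho (vsval H) v = (weight_form l H : F) *: v &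
     forall b x, is_root b -> nonneg_comb (simple_root D) b ->
       in_root_space b x -> rho x v = 0]].

End Weights.

Definition nonzero (F : fieldType) : Type := {a : F | a != 0}.
HB.instance Definition _ (F : fieldType) := Choice.on (nonzero F).

Section SpectralCharacters.
Variables (F : fieldType) (g : finLieAlgType F) (D : cartan_datum g).

Record drinfeld := Drinfeld {
  drinfeld_poly :> 'I_(rank D) -> {poly F};
  drinfeld_polyP : forall i, (drinfeld_poly i)`_0 = 1
}.

Definition drinfeld_eval_poly (l : weight D) (a : nonzero F) i : {poly F} :=
  (1 - val a *: 'X) ^+ `|pairing l i|%N.

Lemma drinfeld_eval_polyP l a i : (drinfeld_eval_poly l a i)`_0 = 1.
Proof.
rewrite -horner_coef0 /drinfeld_eval_poly horner_exp !hornerE.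
by rewrite ?mulr0 subr0 expr1n.
Qed.

(* pi_(l, a); only meaningful for l dominant *)
Definition drinfeld_eval (l : weight D) (a : nonzero F) : drinfeld :=
  Drinfeld (drinfeld_eval_polyP l a).

Definition is_factorization (p : drinfeld) (s : seq (weight D * nonzero F)) : Prop :=
  [/\ uniq [seq x.2 | x <- s],
      forall x, x \in s -> dominant x.1 /\ x.1 <> 0 &
      forall i, p i = \prod_(x <- s) drinfeld_eval x.1 x.2 i].

(* Every p has exactly one such factorization, up to order. *)
Definition factorization (p : drinfeld) : seq (weight D * nonzero F) :=
  xget [::] [set s | is_factorization p s]%classic.

Definition eval_rep (M : vectType F) (rho : g -> 'End(M)) (a : nonzero F) :
  loop g -> 'End(M) := fun X => rho (loop_eval (val a) X).

(* sigma is a realization of V(p), i.e. of the tensor product of the modules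
   V(pi_(l_j, a_j)) over the factors pi_(l_j, a_j) of p. *)
Definition is_loop_simple (p : drinfeld) (M : vectType F)
    (sigma : loop g -> 'End(M)) : Prop :=
  let s := in_tuple (factorization p) in
  exists (W : 'I_(size (factorization p)) -> vectType F)
         (rho : forall j, g -> 'End(W j)),
    (forall j, is_highest_weight_simple (tnth s j).1 (rho j)) /\
    tensor_rep (fun j => eval_rep (rho j) (tnth s j).2) sigma.

(* Xi: functions F^* -> P / Q with finite support *)
Definition spectral : Type := {malg (weight_class D)[nonzero F]}.
HB.instance Definition _ := GRing.Zmodule.on spectral.

Definition spectral_eval (l : weight D) (a : nonzero F) : spectral :=
  << class_of_weight l *g a >>.

Definition spectral_char (p : drinfeld) : spectral :=
  \sum_(x <- factorization p) spectral_eval x.1 x.2.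

Definition has_spectral_char (V : vectType F) (rho : loop g -> 'End(V))
    (chi : spectral) : Prop :=
  forall (p : drinfeld) (M : vectType F) (sigma : loop g -> 'End(M)),
    is_loop_simple p sigma -> irreducible_constituent rho sigma ->
    spectral_char p = chi.

End SpectralCharacters.

(* Main.v *)
From HB Require Import structures.
Require Import Defs.
From mathcomp Require Import all_boot all_order all_algebra.
From mathcomp Require Import complex reals.
From mathcomp Require Import finmap monalg boolp.

Set Implicit Arguments.
Unset Strict Implicit.
Unset Printing Implicit Defensive.
Import GRing.Theory.
Local Open Scope ring_scope.

(* The operators by which [h (x) C[t, 1/t]] acts on a module [V] commute, so the
   algebra they generate contains elements [e] with sum [1] such that each
   operator has a single eigenvalue on the image of [e]; these eigenvalues form
   a functional [l e] on [h (x) C[t, 1/t]]. If [x] is a root vector for [b] and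
   [f (x t^k) e <> 0], then [l f = l e + b (x) ev_a] for some [a <> 0]: the maps
   [f (x t^j) e] span a finite-dimensional space on which [j |-> j + 1] acts, and
   an eigenvector for the eigenvalue [a] shifts [l] by exactly this amount. Hence
   the classes of the functionals modulo [Q (x) ev_a, a <> 0], split [V] into
   submodules, and only one class occurs if [V] is indecomposable. The tensor of
   highest weight vectors of a constituent [V(pi)] has the character
   [sum_j lambda_j (x) ev_(a_j)], which must be one of the functionals, and as
   evaluations at distinct points are linearly independent, the class of this
   character determines the spectral character of [pi]. *)

(** * Commuting operators *)

Section Shifts.
Variables (F : fieldType) (W : vectType F) (D : 'End(W)).
Implicit Types (p : {poly F}) (w : W) (rs : seq F).

Definition poly_act p w : W := \sum_(i < size p) p`_i *: iter i D w.

Lemma poly_actEw n p w : (size p <= n)%N ->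
  poly_act p w = \sum_(i < n) p`_i *: iter i D w.
Proof.
move=> le_pn; rewrite /poly_act (big_ord_widen n (fun i => p`_i *: iter i D w)) //.
rewrite big_mkcond; apply: eq_bigr => i _; case: ltnP => // le_pi.
by rewrite nth_default ?scale0r.
Qed.

Lemma poly_actMXsubC p a w :
  poly_act (p * ('X - a%:P)) w = poly_act p (D w - a *: w).
Proof.
have iterB i : iter i D (D w - a *: w) = iter i.+1 D w - a *: iter i D w.
  by elim: i => //= i ->; rewrite linearB linearZ.
rewrite (@poly_actEw (size p).+1); last first.
  by rewrite (leq_trans (size_polyMleq _ _)) // size_XsubC addn2.
under eq_bigr do rewrite mulrBr coefB coefMX coefMC scalerBl.
rewrite sumrB big_ord_recl /= scale0r add0r.
rewrite [X in _ - X]big_ord_recr /= [p`_(size p)]nth_default // mul0r scale0r addr0.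
rewrite -sumrB; apply: eq_bigr => i _.
by rewrite iterB scalerBr scalerA.
Qed.

(** The product of the [D - a], [a] in [rs], applied to [w] one factor at a time, so that inductions
    can follow the intermediate vectors. *)
Definition shifts rs w := foldl (fun u a => D u - a *: u) w rs.

Lemma poly_act_split c rs w :
  poly_act (c *: \prod_(z <- rs) ('X - z%:P)) w = c *: shifts rs w.
Proof.
elim: rs w => [|a rs IH] w.
  rewrite big_nil alg_polyC (@poly_actEw 1) ?size_polyC ?leq_b1 //.
  by rewrite big_ord1 coefC.
by rewrite big_cons mulrC scalerAl poly_actMXsubC IH.
Qed.

(** The last nonzero vector in the chain from [w] to [0] is an eigenvector; [P] keeps it inside a
    given invariant set. *)
Lemma shifts_eigenvector (P : W -> Prop) rs w : P w -> w <> 0 ->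
    (forall u a, P u -> P (D u - a *: u)) -> shifts rs w = 0 ->
  exists u a, [/\ P u, u <> 0, a \in rs & D u = a *: u].
Proof.
move=> Pw w0 Pshift; elim: rs => [|a rs IH] in w Pw w0 *; first by move/w0.
have [/eqP|/eqP n0 /= e] := eqVneq (D w - a *: w) 0.
  by rewrite subr_eq0 => /eqP Dw _; exists w, a; rewrite mem_head.
have [u [b [Pu u0 brs Du]]] := IH _ (Pshift _ _ Pw) n0 e.
by exists u, b; rewrite inE brs orbT.
Qed.

End Shifts.

(** * Eigenvectors over an algebraically closed field *)

Section Eigenvectors.
Variables (F : closedFieldType) (W : vectType F) (D : 'End(W)).

(** The first [dim W + 1] iterates of [w] are linearly dependent, so a nonzero polynomial in [D]
    kills [w], and it splits into linear factors. *)
Lemma ex_shifts (w : W) : exists rs, shifts D rs w = 0.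
Proof.
pose n := \dim {:W}; pose X := [tuple iter i D w | i < n.+1].
have /freeP nfX : ~~ free X.
  apply/negP => /eqP fX; have := dimvS (subvf <<X>>%VS).
  by rewrite fX size_tuple ltnn.
have [k [k0 [i ki]]] : exists k : 'I_n.+1 -> F,
    \sum_(i < n.+1) k i *: X`_i = 0 /\ exists i, k i <> 0.
  apply: contrapT => nk; apply: nfX => k k0 i; apply: contrapT => ki.
  by apply: nk; exists k; split=> //; exists i.
pose p := \poly_(i < n.+1) k (inord i).
have p0 : poly_act D p w = 0.
  rewrite (poly_actEw _ _ (size_poly _ _)) -[RHS]k0; apply: eq_bigr => j _.
  by rewrite coef_poly ltn_ord inord_val -tnth_nth tnth_mktuple.
have [rs ep] := closed_field_poly_normal p.
exists rs; apply/eqP; move: p0; rewrite ep poly_act_split => /eqP.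
rewrite scaler_eq0 lead_coef_eq0 => /orP[/eqP pz|//].
by case: ki; have := coef_poly n.+1 (k \o inord) i; rewrite -/p pz coef0 ltn_ord /= inord_val.
Qed.

Lemma ex_eigenvector (P : W -> Prop) (w : W) : P w -> w <> 0 ->
    (forall u a, P u -> P (D u - a *: u)) ->
  exists u a, [/\ P u, u <> 0 & D u = a *: u].
Proof.
move=> Pw w0 Pshift; have [rs] := ex_shifts w.
by case/(shifts_eigenvector Pw w0 Pshift) => u [a [Pu u0 _ Du]]; exists u, a.
Qed.

(** Induction on a chain of factors killing [w]. If [(D - b)^m] kills [(D - a) w] with [a != b],
    then [(D - b)^m w] is zero, as otherwise it would be an eigenvector for [a]. *)
Lemma unique_eigenvalue_nilpotent (P : W -> Prop) (b : F) (w : W) : P w ->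
    (forall u a, P u -> P (D u - a *: u)) ->
    (forall u a, P u -> u <> 0 -> D u = a *: u -> a = b) ->
  exists m, shifts D (nseq m b) w = 0.
Proof.
move=> Pw Pshift Pb; have [rs] := ex_shifts w.
elim: rs => [|a rs IH] in w Pw *; first by exists 0%N.
move=> /= /(IH _ (Pshift _ a Pw))[m em].
have [e|ne] := eqVneq a b; first by exists m.+1; move: em; rewrite e.
exists m; apply: contrapT => n0.
have Pm : P (shifts D (nseq m b) w).
  by elim: (m) w Pw {em n0} => //= k IHk u Pu; apply/IHk/Pshift.
move/eqP: ne; apply; apply: (Pb _ _ Pm n0); apply/eqP; rewrite -subr_eq0 -em.
apply/eqP; elim: (m) (w) => //= k IHk u; rewrite IHk; congr shifts.
rewrite !(linearB D) !(linearZ_LR D) /= !scalerBr !scalerA mulrC !opprB !addrA.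
by rewrite addrAC [RHS]addrAC; congr (_ + _); apply: addrAC.
Qed.

End Eigenvectors.

(** * The unital algebra generated by commuting operators *)

Section CommutingOperators.
Variables (F : closedFieldType) (V : vectType F) (T : Type) (s : T -> 'End(V)).
Hypothesis s_comm : forall t u v, s t (s u v) = s u (s t v).
Implicit Types (e f R Z : 'End(V)) (l m : T -> F).

Inductive generated : 'End(V) -> Prop :=
| generated1 : generated \1%VF
| generated_op t : generated (s t)
| generatedD e f : generated e -> generated f -> generated (e + f)
| generatedZ a e : generated e -> generated (a *: e)
| generatedM e f : generated e -> generated f -> generated (e \o f)%VF.

Lemma generated_stable e (U : {vspace V}) : generated e ->
  (forall t u, u \in U -> s t u \in U) -> forall u, u \in U -> e u \in U.
Proof.
move=> + sU; elim=> [|t|e1 e2 _ IH1 _ IH2|a e1 _ IH|e1 e2 _ IH1 _ IH2] u uU.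
- by rewrite lfunE.
- exact: sU.
- by rewrite lfunE memvD ?IH1 ?IH2.
- by rewrite lfunE memvZ ?IH.
- by rewrite lfunE /= IH1 ?IH2.
Qed.

Lemma generated_comm e R : generated e ->
  (forall t v, s t (R v) = R (s t v)) -> forall v, e (R v) = R (e v).
Proof.
move=> + sR; elim=> [|t|e1 e2 _ IH1 _ IH2|a e1 _ IH|e1 e2 _ IH1 _ IH2] v.
- by rewrite !lfunE.
- exact: sR.
- by rewrite !lfunE /= IH1 IH2 linearD.
- by rewrite !lfunE /= IH linearZ.
- by rewrite !lfunE /= IH2 IH1.
Qed.

Lemma generated_opC e t v : generated e -> s t (e v) = e (s t v).
Proof. by move=> ge; rewrite (generated_comm ge) // => u w; apply: s_comm. Qed.

(** Only eigenvectors in the image are tested; for a generated [e] this already makes [s t - l t]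
    nilpotent on the image, by [primary_nilpotent]. *)
Definition primary e l :=
  forall t a v, e v <> 0 -> s t (e v) = a *: e v -> a = l t.

Lemma image_shift e t : generated e ->
  forall u a, (exists v, u = e v) -> exists v, s t u - a *: u = e v.
Proof.
move=> ge u a [v ->]; exists (s t v - a *: v).
by rewrite (linearB e) (linearZ_LR e) /= generated_opC.
Qed.

Lemma primary_unique e l m : generated e -> e <> 0 -> primary e l -> primary e m -> l = m.
Proof.
move=> ge e0 pl pm; apply/funext => t.
have /eqP/lfunPn[v /eqP] := e0; rewrite lfunE /= => ev.
have [||_ [a [[w ->] ew sw]]] := @ex_eigenvector _ _ (s t) (fun u => exists v, u = e v) _ _ ev.
- by exists v.
- exact: image_shift.
by rewrite -(pl _ _ _ ew sw) (pm _ _ _ ew sw).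
Qed.

Lemma primary_nilpotent e l t v : generated e -> primary e l ->
  exists k, shifts (s t) (nseq k (l t)) (e v) = 0.
Proof.
move=> ge pe; apply: (@unique_eigenvalue_nilpotent _ _ _ (fun u => exists v, u = e v)).

- by exists v.
- exact: image_shift.
- by move=> u a [w ->] ew; apply: pe.
Qed.

(** Since [(s t - l t - c) Z = Z (s t - l t)], a power of [s t - (l t + c)] kills the nonzero vector
    [Z v]. This vector lies in the image of [f], where [m t] is the only eigenvalue of [s t]. *)
Lemma primary_shift e l f m R Z t c : generated e -> generated f ->
    primary e l -> primary f m -> (forall v, Z v = f (R (e v))) -> Z <> 0 ->
    (forall v, s t (Z v) - Z (s t v) = c *: Z v) ->
  m t = l t + c.
Proof.
move=> ge gf pe pf ZE Z0 ZC.
have [v Zv] : exists v, Z v <> 0.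
  by have /eqP/lfunPn[v /eqP] := Z0; rewrite lfunE /= => Zv; exists v.
have [k ek] := primary_nilpotent t v ge pe.
have shiftZ : shifts (s t) (nseq k (l t + c)) (Z v) = 0.
  suff -> w : shifts (s t) (nseq k (l t + c)) (Z w) =
              f (R (shifts (s t) (nseq k (l t)) (e w))) by rewrite ek !linear0.
  elim: k {ek} w => //= k IHk w.
  have -> : s t (Z w) - (l t + c) *: Z w = Z (s t w - l t *: w).
    have -> : s t (Z w) = c *: Z w + Z (s t w) by rewrite -ZC subrK.
    rewrite (linearB Z) (linearZ_LR Z) /= scalerDl opprD [- _ - _]addrC.
    by rewrite addrACA subrr add0r.
  by rewrite IHk (linearB e) (linearZ_LR e) /= generated_opC.
have [||_ [a [[w ->] fw]]] :=
    @shifts_eigenvector _ _ (s t) (fun u => exists v, u = f v) _ _ _ Zv _ shiftZ.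
- by rewrite ZE; exists (R (e v)).
- exact: image_shift.
by rewrite mem_nseq => /andP[_ /eqP ->] /(pf _ _ _ fw).
Qed.

(** Induction on the rank of [e], splitting as long as some [s t] has two eigenvalues on the image.
    The summands need be neither idempotent nor orthogonal, and several may share a functional. *)
Lemma ex_primary_sum e : generated e ->
  exists es : seq 'End(V), \sum_(f <- es) f = e /\
    forall f, f \in es -> [/\ generated f, f <> 0 & exists l, primary f l].
Proof.
have [n] := ubnP (\dim (limg e)); elim: n e => // n IH e lt_n ge.
have [e0|/eqP e0] := eqVneq e 0; first by exists [::]; rewrite big_nil.
have [pe|npe] := pselect (forall t a b v w, e v <> 0 -> e w <> 0 ->
    s t (e v) = a *: e v -> s t (e w) = b *: e w -> a = b).
  exists [:: e]; rewrite big_seq1; split=> // f; rewrite inE => /eqP ->; split=> //.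
  have [l le] : {l : T -> F & forall t a v, e v <> 0 -> s t (e v) = a *: e v -> a = l t}.
    apply: (@choice _ _ (fun t b => forall a v, e v <> 0 -> s t (e v) = a *: e v -> a = b)) => t.
    have [[b [w [ew sw]]]|nb] := pselect (exists b w, e w <> 0 /\ s t (e w) = b *: e w).
      by exists b => a v ev sv; apply: pe ev ew sv sw.
    (* A default value: without an eigenvector of [s t] in the image of [e] the condition is
       vacuous. *)
    by exists 0 => a v ev sv; case: nb; exists a, v.
  by exists l.
have [t [a [b [v [w [ev ew sv sw ab]]]]]] : exists t a b v w,
    [/\ e v <> 0, e w <> 0, s t (e v) = a *: e v, s t (e w) = b *: e w & a <> b].
  apply: contrapT => nx; apply: npe => t a b v w ev ew sv sw; apply: contrapT => ab.
  by apply: nx; exists t, a, b, v, w.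
(* [e = ((s t - a) e - (s t - b) e) / (b - a)], and both terms have smaller
   rank, as [a] and [b] are eigenvalues of [s t] on the image of [e]. *)
pose part c : 'End(V) := ((s t - c *: \1) \o e)%VF.
have part_split c d u : e u <> 0 -> s t (e u) = c *: e u -> d != 0 ->
    exists es : seq 'End(V), \sum_(f <- es) f = d *: part c /\
      forall f, f \in es -> [/\ generated f, f <> 0 & exists l, primary f l].
  move=> eu su d0; apply: IH; last first.
    apply: generatedZ; apply: generatedM => //; rewrite -scaleNr.
    by apply: generatedD; [apply: generated_op | apply/generatedZ/generated1].
  apply: leq_trans (_ : _ <= \dim (limg e))%N _; last by rewrite -ltnS.
  have -> : d *: part c = ((d *: (s t - c *: \1)) \o e)%VF by rewrite comp_lfunZl.
  rewrite limg_comp; set D := d *: _.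
  rewrite -(limg_ker_dim D (limg e)) -[X in (X < _)%N]add0n ltn_add2r lt0n dimv_eq0.
  have Du : D (e u) = 0.
    by rewrite scale_lfunE add_lfunE opp_lfunE scale_lfunE id_lfunE su subrr scaler0.
  apply/eqP => /vspaceP/(_ (e u)); rewrite memv_cap memv_img ?memvf // memv_ker.
  by rewrite Du eqxx memv0 => /esym/eqP.
have ba : (b - a)^-1 != 0 by rewrite invr_eq0 subr_eq0; apply/eqP => /esym.
have [es1 [s1 p1]] := part_split a (b - a)^-1 v ev sv ba.
have ba' : - (b - a)^-1 != 0 by rewrite oppr_eq0.
have [es2 [s2 p2]] := part_split b (- (b - a)^-1) w ew sw ba'.
exists (es1 ++ es2); split=> [|f]; last by rewrite mem_cat => /orP[/p1|/p2].
rewrite big_cat /= s1 s2 scaleNr -scalerBr; apply/lfunP => u.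
rewrite scale_lfunE add_lfunE opp_lfunE !comp_lfunE !(add_lfunE, opp_lfunE) !scale_lfunE.
rewrite !id_lfunE opprB [X in _ *: X]addrC addrA subrK -scalerBl scalerA.
by rewrite mulVf ?scale1r // -invr_eq0.
Qed.

End CommutingOperators.

(** * Root vectors *)

(** In coordinates for the eigenbasis, [D - a] multiplies the [i]-th coordinate by [c i - a], and a
    field has no nonzero nilpotents. *)
Lemma diagonal_nilpotent (F : fieldType) (W : vectType F) (D : 'End(W)) (X : seq W)
    (a : F) (k : nat) (y : W) : basis_of fullv X ->
    (forall x, x \in X -> exists c : F, D x = c *: x) ->
  shifts D (nseq k a) y = 0 -> D y = a *: y.
Proof.
move=> Xb DX e0; pose T := in_tuple X.
have Tb : basis_of fullv T by [].
have [c cE] := fin_all_exists (fun i : 'I_(size X) => DX _ (mem_nth 0 (ltn_ord i))).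
have coordD i u : coord T i (D u - a *: u) = (c i - a) * coord T i u.
  rewrite linearB linearZ /= mulrBl; congr (_ - _).
  rewrite {1}(coord_basis Tb (memvf u)) linear_sum.
  under eq_bigr do rewrite linearZ /= cE scalerA.
  by rewrite (coord_sum_free _ _ (basis_free Tb)) mulrC.
have coordN i : coord T i (shifts D (nseq k a) y) = (c i - a) ^+ k * coord T i y.
  elim: (k) (y) => [|n IH] u; first by rewrite expr0 mul1r.
  by rewrite /= IH coordD exprSr mulrA.
apply/eqP; rewrite -subr_eq0; apply/eqP.
rewrite (coord_basis Tb (memvf (D y - a *: y))) big1 // => i _.
have := coordN i; rewrite e0 linear0 coordD => /esym/eqP.
by rewrite mulf_eq0 expf_eq0 => /orP[/andP[_ /eqP->]|/eqP->]; rewrite ?mul0r ?mulr0 scale0r.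
Qed.

Section RootDecomposition.
Variables (F : closedFieldType) (g : finLieAlgType F) (D : cartan_datum g).
Local Notation h := (cartan D).

(** The condition of [root_lattice], on functionals instead of integral weights, so that it can be
    stated for roots directly. *)
Definition in_root_span (b : dual h) : Prop :=
  exists c : 'I_(rank D) -> int, b = \sum_i simple_root D i *~ c i.

Lemma in_root_span0 : in_root_span 0.
Proof. by exists (fun=> 0); rewrite big1. Qed.

Lemma in_root_spanN b : in_root_span b -> in_root_span (- b).
Proof.
case=> c ->; exists (fun i => - c i); rewrite -sumrN.
by apply: eq_bigr => i _; rewrite mulrNz.
Qed.

Lemma in_root_spanD b1 b2 : in_root_span b1 -> in_root_span b2 -> in_root_span (b1 + b2).
Proof.
case=> c1 -> [c2 ->]; exists (fun i => c1 i + c2 i); rewrite -big_split.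
by apply: eq_bigr => i _; rewrite mulrzDr.
Qed.

Lemma is_root_in_root_span (b : dual h) : is_root b -> in_root_span b.
Proof.
have nonneg b' : nonneg_comb (simple_root D) b' -> in_root_span b'.
  by case=> c ->; exists (fun i => Posz (c i)).
have [_ _ rootP] := simple_rootP D.
by case/rootP => /nonneg // /in_root_spanN; rewrite opprK.
Qed.

Let ad_op (H : subvs_of h) : 'End(g) := linfun (lie (vsval H)).

Lemma ad_cartan_comm (H K : subvs_of h) v : ad_op H (ad_op K v) = ad_op K (ad_op H v).
Proof.
have [habel _ _] := cartanP D.
have := lie_jacobi (vsval H) (vsval K) v; rewrite !lfunE /=.
rewrite [lie (vsval H) (vsval K)]habel ?subvsP // linear0 addr0.
by rewrite [lie v _]lieC linearN /= => /eqP; rewrite subr_eq0 => /eqP.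
Qed.

(** The root space decomposition, from [ex_primary_sum] for the operators [ad H]:
    ad-diagonalizability makes each summand of [x] a true common eigenvector, and if nonzero its
    functional is [0] or a root. *)
Lemma root_space_sum (x : g) : exists ys : seq g, x = \sum_(y <- ys) y /\
  forall y, y \in ys -> exists2 b : dual h, in_root_span b & in_root_space b y.
Proof.
have [es [sum_es esP]] := ex_primary_sum (generated1 ad_op).
exists [seq e x | e : 'End(g) <- es]; split=> [|y].
  by rewrite big_map -sum_lfunE sum_es lfunE.
case/mapP => e /esP[ge _ [l pl]] ->; set z := e x.
have [z0|/eqP z0] := eqVneq z 0.
  by exists 0; [exact: in_root_span0 | move=> H; rewrite z0 linear0 scaler0].
have lz H : lie (vsval H) z = l H *: z.
  have [_ _ /(_ _ (subvsP H))[X Xb XP]] := cartanP D.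
  have [k] := primary_nilpotent ad_cartan_comm H x ge pl.
  move/(diagonal_nilpotent Xb); rewrite lfunE; apply=> u /XP[c cE].
  by exists c; rewrite lfunE.
(* Linearity of the eigenvalue in [H] is read off from the action on the nonzero vector [z]. *)
have l_linear : linear (l : subvs_of h -> F^o).
  move=> c H K; apply/eqP; rewrite -subr_eq0; apply/eqP.
  apply: contrapT => n0; apply: z0.
  have : (l (c *: H + K) - (c * l H + l K)) *: z = 0.
    rewrite scalerBl scalerDl -!lz -scalerA -lz.
    by rewrite vsval_is_linear lie_linearl subrr.
  by move/eqP; rewrite scaler_eq0 => /orP[/eqP/n0|/eqP].
pose lf : {linear subvs_of h -> F^o} :=
  HB.pack l (GRing.isLinear.Build F (subvs_of h) F^o *:%R l l_linear).
pose b : dual h := linfun lf.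
have zb : in_root_space b z by move=> H; rewrite lfunE.
exists b => //; have [->|/eqP b0] := eqVneq b 0; first exact: in_root_span0.
by apply: is_root_in_root_span; split=> //; exists z.
Qed.

End RootDecomposition.

(** * Classes of characters in an indecomposable module *)

Section Blocks.
Variables (F : closedFieldType) (g : finLieAlgType F) (D : cartan_datum g).
Variables (V : vectType F) (rho : loop g -> 'End(V)).
Hypothesis rho_rep : is_rep rho.
Local Notation h := (cartan D).
Implicit Types (l m : subvs_of h * int -> F) (e f : 'End(V)).

Definition mono (x : g) (k : int) : loop g := << x *g k >>.
Definition cartan_op (t : subvs_of h * int) : 'End(V) := rho (mono (vsval t.1) t.2).

Lemma rep_lie X Y v : rho X (rho Y v) - rho Y (rho X v) = rho (lie X Y) v.
Proof. by case: rho_rep => _ ->. Qed.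

Lemma rep_linear : linear rho. Proof. by case: rho_rep. Qed.

HB.instance Definition _ := GRing.isLinear.Build F (loop g) 'End(V) *:%R rho rep_linear.

Lemma cartan_op_lie t (b : dual h) x k v : in_root_space b x ->
  cartan_op t (rho (mono x k) v) - rho (mono x k) (cartan_op t v) =
  b t.1 *: rho (mono x (t.2 + k)) v.
Proof.
by move=> bx; rewrite rep_lie loop_lieE bx monalgUZ linearZ /= lfunE.
Qed.

Lemma cartan_op_comm t u v : cartan_op t (cartan_op u v) = cartan_op u (cartan_op t v).
Proof.
have [habel _ _] := cartanP D; apply/eqP; rewrite -subr_eq0 rep_lie loop_lieE.
by rewrite habel ?subvsP // monalgU0 linear0 lfunE.
Qed.

(** Congruence modulo the [b (x) ev_a] with [b] in [Q] and [a != 0]. Points may repeat in [q], so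
    that transitivity is concatenation. *)
Definition linked l m : Prop := exists q : seq (dual h * F),
  (forall x, x \in q -> in_root_span x.1 /\ x.2 != 0) /\
  forall H k, m (H, k) = l (H, k) + \sum_(x <- q) (x.1 H : F) * x.2 ^ k.

Lemma linked_refl l : linked l l.
Proof. by exists [::]; split=> // H k; rewrite big_nil addr0. Qed.

Lemma linked_sym l m : linked l m -> linked m l.
Proof.
case=> q [qP lm]; exists [seq (- x.1, x.2) | x <- q]; split=> [x|H k].
  by case/mapP => y /qP[y1 y2] ->; split=> //; apply: in_root_spanN.
rewrite lm big_map -addrA -big_split big1 ?addr0 //= => x _.
by rewrite opp_lfunE mulNr subrr.
Qed.

Lemma linked_trans m l n : linked l m -> linked m n -> linked l n.
Proof.
case=> q [qP lm] [r [rP mn]]; exists (q ++ r); split=> [x|H k].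
  by rewrite mem_cat => /orP[/qP|/rP].
by rewrite mn lm big_cat addrA.
Qed.

Lemma root_vector_linked e f l m (b : dual h) x k : generated cartan_op e ->
    generated cartan_op f -> primary cartan_op e l -> primary cartan_op f m ->
    in_root_span b -> in_root_space b x ->
  (f \o (rho (mono x k) \o e))%VF <> 0 -> linked l m.
Proof.
move=> ge gf pe pf bQ bx.
pose Y j := (f \o (rho (mono x j) \o e))%VF.
have YC t j v : cartan_op t (Y j v) - Y j (cartan_op t v) = b t.1 *: Y (t.2 + j) v.
  rewrite !comp_lfunE -(generated_opC cartan_op_comm _ _ ge).
  by rewrite (generated_opC cartan_op_comm _ _ gf) -linearB /= (cartan_op_lie _ _ _ bx) linearZ.
(* It suffices to find a nonzero [f R e] which every commutator with [H t^j] multiplies by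
   [b(H) a^j]. *)
have linkedI (Z R : 'End(V)) (a : F) : (forall v, Z v = f (R (e v))) -> Z <> 0 -> a != 0 ->
    (forall t v, cartan_op t (Z v) - Z (cartan_op t v) = (b t.1 * a ^ t.2) *: Z v) ->
    linked l m.
  move=> ZE Z0 a0 ZC; exists [:: (b, a)]; split=> [y|H j].
    by rewrite inE => /eqP ->.
  rewrite big_seq1 /=.
  exact: (primary_shift cartan_op_comm ge gf pe pf ZE Z0 (ZC (H, j))).
have [b0|] := eqVneq b 0.
  (* For [b = 0] these commutators vanish and any nonzero point serves; [1] is taken. *)
  move=> Yk0; apply: (linkedI (Y k) (rho (mono x k)) 1) => //.
  - by move=> v; rewrite !comp_lfunE.
  - exact: oner_neq0.
  - by move=> t v; rewrite YC b0 lfunE !mul0r !scale0r.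
case/lfunPn => H1; rewrite lfunE /= => bH1 Yk0.
(* Normalised so that the commutator with [H0 t] is exactly the shift of the index by one. *)
pose H0 := (b H1)^-1 *: H1.
have bH0 : b H0 = 1 by rewrite linearZ /= [_ *: _]mulVf.
(* [Y j |-> Y (j + 1)] is the restriction of the operator [ad (H0 t)], so some
   combination of the [Y j] is a common eigenvector of all shifts. *)
pose ad (Z : 'End(V)) := ((cartan_op (H0, 1) \o Z) - (Z \o cartan_op (H0, 1)))%VF.
have ad_linear : linear ad.
  move=> c Z1 Z2; apply/lfunP => v.
  rewrite !(add_lfunE, opp_lfunE, scale_lfunE, comp_lfunE) linearD linearZ /=.
  by rewrite scalerBr opprD addrACA.
pose adL : {linear 'End(V) -> 'End(V)} :=
  HB.pack ad (GRing.isLinear.Build F _ _ *:%R ad ad_linear).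
(* [Z] is placed at index 0 of a whole family obeying the commutation rule of the [Y j]. Unlike
   being some [Y j], this property passes to the family [Zs (j + 1) - a *: Zs j]. *)
pose P (Z : 'End(V)) := exists Zs : int -> 'End(V), [/\ Zs 0 = Z,
  forall j, exists R : 'End(V), forall v, Zs j v = f (R (e v)) &
  forall t j v, cartan_op t (Zs j v) - Zs j (cartan_op t v) = b t.1 *: Zs (t.2 + j) v].
have PY : P (Y k).
  exists (fun j => Y (k + j)); split=> [|j|t j v]; first by rewrite addr0.
    by exists (rho (mono x (k + j))) => v; rewrite !comp_lfunE.
  by rewrite YC addrCA.
have adE (Zs : int -> 'End(V)) :
    (forall t j v, cartan_op t (Zs j v) - Zs j (cartan_op t v) = b t.1 *: Zs (t.2 + j) v) ->
    linfun adL (Zs 0) = Zs 1.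
  move=> ZsC; rewrite lfunE; apply/lfunP => v.
  by rewrite /= /ad add_lfunE opp_lfunE !comp_lfunE ZsC /= bH0 scale1r addr0.
have [|Z [a [[Zs [<- ZsE ZsC]] Z0 adZ]]] := @ex_eigenvector _ _ (linfun adL) P _ PY Yk0.
  move=> _ a [Zs [<- ZsE ZsC]]; exists (fun j => Zs (j + 1) - a *: Zs j); split=> [|j|t j v].
  - by rewrite add0r adE.
  - have [[R1 E1] [R2 E2]] := (ZsE (j + 1), ZsE j); exists (R1 - a *: R2) => v.
    by rewrite /= !(add_lfunE, opp_lfunE, scale_lfunE) E1 E2 (linearB f) (linearZ_LR f).
  - rewrite /= !(add_lfunE, opp_lfunE, scale_lfunE).
    rewrite (linearB (cartan_op t)) (linearZ_LR (cartan_op t)) /= opprD opprK addrACA ZsC.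
    rewrite [- _ + _]addrC -opprB -scalerBr ZsC addrA scalerBr !scalerA.
    by rewrite [a * _]mulrC.
(* The commutators of [H0 t^j] with [Zs 0] and with [Zs 1 = a *: Zs 0] are [Zs j] and
   [Zs (j + 1)]. *)
have ZsS j : Zs (j + 1) = a *: Zs j.
  apply/lfunP => v; have := ZsC (H0, j) 1 v; rewrite /= bH0 scale1r => <-.
  rewrite -(adE Zs) // adZ !scale_lfunE linearZ /= -scalerBr ZsC /= bH0 scale1r.
  by rewrite addr0.
(* Negative powers of [t] enter here: [Zs 0] is the shift of [Zs (-1)], so [a = 0] would make it
   zero. *)
have a0 : a != 0.
  by apply: contra_notN Z0 => /eqP a0; rewrite -[0 in LHS](addNr 1) ZsS a0 scale0r.
have Zspow j : Zs j = a ^ j *: Zs 0.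
  elim/int_rec: j => [|n IH|n IH]; first by rewrite expr0z scale1r.
    by rewrite exprSz -scalerA -IH -ZsS -addn1 PoszD.
  have := ZsS (- n.+1%:Z); rewrite intS opprD addrAC addNr add0r IH => aZ.
  rewrite -opprD -intS -exprz_inv exprSz -scalerA exprz_inv aZ scalerA mulVf // scale1r.
  by rewrite intS opprD.
have [R RE] := ZsE 0.
apply: (linkedI _ R a RE Z0 a0) => t v.
by rewrite ZsC addr0 Zspow scale_lfunE scalerA.
Qed.

Lemma root_space_ind (P : loop g -> Prop) : P 0 -> (forall X Y, P X -> P Y -> P (X + Y)) ->
    (forall (b : dual h) x k, in_root_span b -> in_root_space b x -> P (mono x k)) ->
  forall X, P X.
Proof.
move=> P0 PD PU; apply: loop_ind => // x k.
have [ys [-> ysP]] := root_space_sum D x.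
elim: ys ysP => [|y ys IH] ysP; first by rewrite big_nil monalgU0.
rewrite big_cons monalgUD; apply: PD.
  by have [b bQ by_] := ysP _ (mem_head y ys); apply: PU bQ by_.
by apply: IH => z zys; apply: ysP; rewrite inE zys orbT.
Qed.

(** The summands linked to [e] and the remaining ones add up to complementary projections [p true]
    and [p false], whose images are submodules. One image is zero; it is not the first because of
    [e], so no summand, in particular not [f], lies outside the class of [e]. *)
Lemma primary_linked (es : seq 'End(V)) e f l m : indecomposable_rep rho ->
    \sum_(f <- es) f = \1%VF ->
    (forall f, f \in es ->
       [/\ generated cartan_op f, f <> 0 & exists l, primary cartan_op f l]) ->
    e \in es -> primary cartan_op e l -> f \in es -> primary cartan_op f m ->
  linked l m.
Proof.
move=> [_ indec] sum_es esP ees pe fes pf.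
pose C (f : 'End(V)) := `[< exists m, primary cartan_op f m /\ linked l m >].
have Cl f1 m1 : f1 \in es -> primary cartan_op f1 m1 -> C f1 -> linked l m1.
  move=> /esP[g1 f10 _] p1 /asboolP[m2 [p2 lm]].
  by rewrite (primary_unique cartan_op_comm g1 f10 p1 p2).
have linkedC f1 f2 m1 m2 : f1 \in es -> f2 \in es -> primary cartan_op f1 m1 ->
    primary cartan_op f2 m2 -> linked m1 m2 -> C f1 = C f2.
  move=> f1es f2es p1 p2 lm; apply/idP/idP => [/(Cl _ _ f1es p1)|/(Cl _ _ f2es p2)] lm1.
    by apply/asboolP; exists m2; split=> //; apply: linked_trans lm.
  by apply/asboolP; exists m1; split=> //; apply: linked_trans (linked_sym lm).
have cross f1 f2 : f1 \in es -> f2 \in es -> C f1 != C f2 ->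
    forall X v, f2 (rho X (f1 v)) = 0.
  move=> f1es f2es /eqP Cne.
  have [[g1 _ [m1 p1]] [g2 _ [m2 p2]]] := (esP _ f1es, esP _ f2es).
  apply: root_space_ind => [v|X Y IHX IHY v|b x k bQ bx v].
  - by rewrite (linear0 rho) lfunE /= linear0.
  - by rewrite (linearD rho) /= add_lfunE (linearD f2) /= IHX IHY addr0.
  apply: contrapT => n0; apply: Cne; apply: (linkedC _ _ _ _ f1es f2es p1 p2).
  apply: (root_vector_linked g1 g2 p1 p2 bQ bx (k := k)) => /lfunP/(_ v).
  by rewrite !comp_lfunE lfunE.
(* [f2 f1] commutes with the Cartan operators, so if it is nonzero the two functionals agree. *)
have cross1 f1 f2 : f1 \in es -> f2 \in es -> C f1 != C f2 -> forall v, f2 (f1 v) = 0.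
  move=> f1es f2es /eqP Cne v.
  have [[g1 _ [m1 p1]] [g2 _ [m2 p2]]] := (esP _ f1es, esP _ f2es).
  apply: contrapT => n0; apply: Cne; apply: (linkedC _ _ _ _ f1es f2es p1 p2).
  exists [::]; split=> // H k; rewrite big_nil.
  apply: (primary_shift cartan_op_comm g1 g2 p1 p2 (R := \1%VF) (Z := (f2 \o f1)%VF)).
  - by move=> w; rewrite comp_lfunE id_lfunE.
  - by move/lfunP/(_ v); rewrite comp_lfunE lfunE.
  - move=> w; rewrite !comp_lfunE !(generated_opC cartan_op_comm) //.
    by rewrite subrr scale0r.
pose p b := \sum_(f <- es | C f == b) f.
have pD v : p true v + p false v = v.
  transitivity ((\sum_(f <- es) f) v); last by rewrite sum_es lfunE.
  rewrite (bigID C) add_lfunE; congr (fun_of_lfun _ v + fun_of_lfun _ v).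
    by apply: eq_bigl => f1; rewrite eqb_id.
  by apply: eq_bigl => f1; rewrite eqbF_neg.
have pX b X v : p b (rho X (p (~~ b) v)) = 0.
  rewrite /p sum_lfunE big_seq_cond big1 // => f2 /andP[f2es /eqP C2].
  rewrite sum_lfunE !linear_sum /= big_seq_cond big1 // => f1 /andP[f1es /eqP C1].
  by rewrite cross // C1 C2; case: (b).
have p0 b v : p b (p (~~ b) v) = 0.
  rewrite /p sum_lfunE big_seq_cond big1 // => f2 /andP[f2es /eqP C2].
  rewrite sum_lfunE !linear_sum /= big_seq_cond big1 // => f1 /andP[f1es /eqP C1].
  by rewrite cross1 // C1 C2; case: (b).
(* If [p b = 0] and [f1] has class [b], then [f1 v = p (~~ b) (f1 v) = 0] for all [v], contradicting
   [f1 <> 0]. *)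
have pN b : limg (p b) = 0%VS -> forall f1, f1 \in es -> C f1 != b.
  move=> pb0 f1 f1es; apply/eqP => C1; have [_ f10 _] := esP _ f1es.
  have pb v : p b v = 0.
    by apply/eqP; rewrite -memv0 -pb0 memv_img ?memvf.
  apply: f10; apply/lfunP => v; rewrite lfunE -[LHS]pD /=.
  have: p (~~ b) (f1 v) = 0.
    rewrite /p sum_lfunE big_seq_cond big1 // => f2 /andP[f2es /eqP C2].
    by rewrite cross1 // C1 C2; case: (b).
  by case: (b) pb => pb; rewrite pb /= => ->; rewrite addr0.
have submod b : submodule rho (limg (p b)).
  move=> X _ /memv_imgP[v _ ->]; apply/memv_imgP.
  exists (rho X (p b v)); rewrite ?memvf // -[LHS]pD.
  by case: (b) (pX (~~ b) X v); rewrite /= => ->; rewrite ?addr0 ?add0r.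
have Ce : C e by apply/asboolP; exists l; split=> //; apply: linked_refl.
case: (indec _ _ (submod true) (submod false)).
- apply/vspaceP => v; rewrite memvf -[v]pD.
  by rewrite memv_add ?memv_img ?memvf.
- apply/vspaceP => v; rewrite memv0; apply/idP/eqP => [|->]; last exact: mem0v.
  rewrite memv_cap => /andP[/memv_imgP[u _ uv] /memv_imgP[w _ wv]].
  by rewrite -[v]pD {1}wv uv (p0 true) (p0 false) addr0.
- by move/pN/(_ _ ees); rewrite Ce.
by move/pN/(_ _ fes); rewrite eqbF_neg negbK => /(Cl _ _ fes pf).
Qed.

End Blocks.

(** * Spectral characters of constituents *)

(** Combine the relations with the coefficients of a polynomial that vanishes at all points of [r]
    other than [a], but not at [a]. *)
Lemma power_sums_eq0 (F : fieldType) (r : seq (F * F)) (a : F) :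
  (forall k : nat, \sum_(x <- r) x.1 * x.2 ^+ k = 0) -> \sum_(x <- r | x.2 == a) x.1 = 0.
Proof.
move=> r0; pose P : {poly F} := \prod_(x <- r | x.2 != a) ('X - x.2%:P).
have Pa : P.[a] != 0.
  rewrite /P horner_prod; elim/big_rec: _ => [|x y xa y0]; first exact: oner_neq0.
  by rewrite mulf_neq0 // hornerXsubC subr_eq0 eq_sym.
have sumP : \sum_(x <- r) x.1 * P.[x.2] = 0.
  under eq_bigr do rewrite horner_coef mulr_sumr.
  rewrite exchange_big big1 //= => k _.
  transitivity (P`_k * \sum_(x <- r) x.1 * x.2 ^+ k); last by rewrite r0 mulr0.
  by rewrite mulr_sumr; apply: eq_bigr => x _; rewrite mulrCA.
apply: (mulIf Pa); rewrite mul0r mulr_suml -[RHS]sumP big_mkcond !big_seq.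
apply: eq_bigr => x xr; case: eqP => [->|/eqP xa] //.
by rewrite /P horner_prod (big_rem x) //= xa hornerXsubC subrr mul0r mulr0.
Qed.

(** A product of functionals, one for each [j] and nonzero at [w j], is multilinear; it factors
    through [tau] and is nonzero at [w]. *)
Lemma pure_tensor_neq0 (F : fieldType) (r : nat) (W : 'I_r -> vectType F)
    (T : vectType F) (tau : (forall j, W j) -> T) (w : forall j, W j) :
  is_tensor_product tau -> (forall j, w j <> 0) -> tau w <> 0.
Proof.
move=> [_ univ] w0.
have ex_phi j : exists phi : 'Hom(W j, F^o), phi (w j) <> 0.
  pose X := vbasis {:W j}.
  have [i /eqP ci] : exists i, coord X i (w j) != 0.
    apply: contrapT => n; apply: (w0 j); rewrite (coord_vbasis (memvf (w j))).
    apply: big1 => i _; have [->|ci] := eqVneq (coord X i (w j)) 0; first exact: scale0r.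
    by case: n; exists i.
  by exists (linfun (coord X i : W j -> F^o)); rewrite lfunE.
have [phi phiw] := fin_all_exists ex_phi.
pose f (u : forall j, W j) : F^o := \prod_j (phi j (u j) : F).
have f_multilinear : multilinear_map f.
  move=> u j.
  have fE x : f (dfwith u x) = phi j x * \prod_(k | k != j) (phi k (u k) : F).
    rewrite /f (bigD1 j) //= dfwith_in; congr (_ * _).
    by apply: eq_bigr => k kj; rewrite dfwith_out // eq_sym.
  by move=> c x y; rewrite !fE linearP mulrDl -scalerAl.
have [psi [psiE _]] := univ _ f f_multilinear.
move=> tau0; have := psiE w; rewrite tau0 linear0 => /esym/eqP/prodf_eq0[j _ /eqP].
exact: phiw.
Qed.

Section SpectralCharacters.
Variables (F : closedFieldType) (g : finLieAlgType F) (D : cartan_datum g).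
Local Notation h := (cartan D).

Definition highest_character (p : drinfeld D) (t : subvs_of h * int) : F :=
  \sum_(x <- factorization p) (weight_form x.1 t.1 : F) * val x.2 ^ t.2.

Lemma spectral_char_coef (p : drinfeld D) a : (spectral_char p)@_a =
  class_of_weight (\sum_(x <- factorization p | x.2 == a) x.1).
Proof.
rewrite /spectral_char (raddf_sum (mcoeff a)) /class_of_weight raddf_sum [RHS]big_mkcond /=.
apply: eq_bigr => x _; rewrite mcoeffU; case: eqP => _.
by rewrite mulr1n.
by rewrite mulr0n.
Qed.

(** [power_sums_eq0] isolates each point [a]: the total weights of [p] and [p'] at [a] differ by an
    element of [Q]. *)
Lemma linked_spectral (p p' : drinfeld D) :
  linked (highest_character p) (highest_character p') -> spectral_char p = spectral_char p'.
Proof.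
case=> q [qP qE]; apply/malgP => a; rewrite !spectral_char_coef.
pose w (p : drinfeld D) := \sum_(x <- factorization p | x.2 == a) x.1.
have wH (p1 : drinfeld D) H : weight_form (w p1) H =
    \sum_(x <- factorization p1 | x.2 == a) (weight_form x.1 H : F^o).
  by rewrite -[weight_form _]/(val (w p1)) raddf_sum sum_lfunE.
suff wE : weight_form (w p) - weight_form (w p') = - \sum_(y <- q | y.2 == val a) y.1.
  apply/eqP; rewrite -Quotient.idealrBE; apply/asboolP.
  rewrite -[weight_form _]/(val (w p - w p')) raddfB /= wE.
  apply: in_root_spanN; rewrite big_seq_cond.
  elim/big_ind: _ => [||y /andP[/qP[]]//]; first exact: in_root_span0.
  exact: in_root_spanD.
apply/lfunP => H; rewrite !(add_lfunE, opp_lfunE) !wH sum_lfunE.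
(* All terms of the relation moved to one side, as pairs of a coefficient and a point. *)
pose r := [seq ((weight_form x.1 H : F), val x.2) | x <- factorization p'] ++
  [seq (- (weight_form x.1 H : F), val x.2) | x <- factorization p] ++
  [seq (- (y.1 H : F), y.2) | y : dual h * F <- q].
have valE (x : weight D * nonzero F) : (val x.2 == val a) = (x.2 == a) by exact: val_eqE.
have r0 (k : nat) : \sum_(x <- r) x.1 * x.2 ^+ k = 0.
  have := qE H k; rewrite /highest_character /= !big_cat !big_map /= => ->.
  under [X in _ + (X + _)]eq_bigr do rewrite mulNr.
  under [X in _ + (_ + X)]eq_bigr do rewrite mulNr.
  by rewrite !sumrN -opprD subrr.
have := power_sums_eq0 (val a) r0; rewrite !big_cat !big_map /= !sumrN addrA.
rewrite !(eq_bigl _ _ valE) => /eqP; rewrite subr_eq0 => /eqP <-.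
by rewrite opprB.
Qed.


(** [H t^k] acts on the [j]-th highest weight vector by [a_j^k lambda_j(H)], and these scalars add
    up on the tensor. *)
Lemma loop_simple_highest_vector (p : drinfeld D) (M : vectType F) (sigma : loop g -> 'End(M)) :
  is_loop_simple p sigma -> exists2 m : M, m <> 0 & forall H k,
    sigma (mono (vsval H) k) m = highest_character p (H, k) *: m.
Proof.
case=> W [rho [hw [tau tau_tensor sigmaE]]]; have [tau_multi _] := tau_tensor.
set s := in_tuple (factorization p) in hw sigmaE.
have [v vP] := fin_all_exists (fun j => let: And3 _ _ v := hw j in v).
exists (tau v); first by apply: pure_tensor_neq0 tau_tensor _ => j; case: (vP j).
move=> H k; rewrite sigmaE /highest_character.
rewrite (big_tnth _ _ (factorization p)) scaler_suml; apply: eq_bigr => j _.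
have [_ vH _] := vP j; have [[rho_lin _] _ _] := hw j.
rewrite /eval_rep loop_evalU.
rewrite (GRing.scalable_linear rho_lin) lfunE /= vH scalerA mulrC.
rewrite (GRing.scalable_linear (tau_multi v j)); congr (_ *: tau _).
by apply: functional_extensionality_dep => i; case: dfwithP.
Qed.

(** Lift the highest weight vector [m] to [w]. As the [e] sum to [1], some [e w] lies over a nonzero
    multiple of [m], and nilpotency on [e w] forces the functional of [e] to be the character of
    [m]. *)
Lemma constituent_character (V : vectType F) (rho : loop g -> 'End(V)) (p : drinfeld D)
    (M : vectType F) (sigma : loop g -> 'End(M)) (es : seq 'End(V)) : is_rep rho ->
    \sum_(e <- es) e = \1%VF ->
    (forall e, e \in es -> [/\ generated (cartan_op (D := D) rho) e, e <> 0 &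
       exists l, primary (cartan_op (D := D) rho) e l]) ->
    is_loop_simple p sigma -> irreducible_constituent rho sigma ->
  exists2 e, e \in es & primary (cartan_op (D := D) rho) e (highest_character p).
Proof.
move=> rho_rep sum_es esP /loop_simple_highest_vector[m m0 sigma_m].
case=> n [W [[_ _ Wsub _] [i lt_in [phi [phiW _ phiE]]]]].
have {}Wsub := Wsub _ lt_in; set U := W i.+1 in phiW phiE Wsub.
have [w wU phiw] : exists2 w, w \in U & phi w = m.
  by have /memv_imgP[w wU ->] : m \in (phi @: U)%VS by [rewrite phiW memvf]; exists w.
(* Every element of the algebra generated by the [cartan_op]s maps [w] to a
   vector lying over a multiple of [m]. *)
pose Um := (U :&: phi @^-1: <[m]>)%VS.
have Um_stable t u : u \in Um -> cartan_op (D := D) rho t u \in Um.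
  rewrite !memv_cap -!memv_preim => /andP[uU /vlineP[c phiu]].
  rewrite Wsub // phiE // phiu linearZ /= [t]surjective_pairing sigma_m.
  by rewrite !memvZ ?memv_line.
have wUm : w \in Um by rewrite memv_cap wU -memv_preim phiw memv_line.
have [e ees phie] : exists2 e, e \in es & phi (e w) <> 0.
  apply: contrapT => n0; apply: m0; rewrite -phiw.
  have -> : w = (\sum_(e <- es) e) w by rewrite sum_es lfunE.
  rewrite sum_lfunE linear_sum big_seq big1 // => e ees.
  by apply: contrapT => phie; apply: n0; exists e.
exists e => //; have [ge _ [l pl]] := esP e ees.
suff <- : l = highest_character p by [].
have := generated_stable ge Um_stable wUm.
rewrite memv_cap -memv_preim => /andP[ewU /vlineP[c phiec]].
have c0 : c <> 0 by move=> c0; apply: phie; rewrite phiec c0 scale0r.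
apply/funext => t.
have [k ek] := primary_nilpotent (cartan_op_comm rho_rep) t w ge pl.
have shift_phi u d : u \in U -> phi u = d *: m ->
    phi (shifts (cartan_op (D := D) rho t) (nseq k (l t)) u) =
    (d * (highest_character p t - l t) ^+ k) *: m.
  elim: (k) u d => [|j IH] u d uU phiu /=; first by rewrite expr0 mulr1.
  rewrite (IH _ (d * (highest_character p t - l t))).
  - by rewrite exprS mulrA.
  - by rewrite memvB ?memvZ ?Wsub.
  - rewrite linearB linearZ /= phiE // phiu linearZ /= sigma_m -surjective_pairing.
    by rewrite !scalerA -scalerBl mulrBr [l t * _]mulrC.
have /esym/eqP := shift_phi _ _ ewU phiec.
rewrite ek linear0 scaler_eq0 mulf_eq0 expf_eq0 subr_eq0.
by case/orP => [/orP[/eqP/c0|/andP[_ /eqP]]|/eqP/m0].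
Qed.

End SpectralCharacters.

Theorem proposition2p4 (R : realType) (g : finLieAlgType R[i]) (g_simple : simple_lie g)
    (D : cartan_datum g) (V : vectType R[i]) (rho : loop g -> 'End(V))
    (rho_rep : is_rep rho) (rho_indec : indecomposable_rep rho) :
  exists chi : spectral D, has_spectral_char rho chi.
Proof.
have [es [sum_es esP]] := ex_primary_sum (generated1 (cartan_op (D := D) rho)).
(* Any one constituent [V(pi)] serves as the reference that defines [chi]. *)
have [[p [M [sigma [sp sc]]]]|none] := pselect (exists (p : drinfeld D)
    (M : vectType R[i]) (sigma : loop g -> 'End(M)),
    is_loop_simple p sigma /\ irreducible_constituent rho sigma).
  exists (spectral_char p) => p' M' sigma' sp' sc'.
  have [e ees pe] := constituent_character rho_rep sum_es esP sp sc.
  have [e' e'es pe'] := constituent_character rho_rep sum_es esP sp' sc'.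
  exact: linked_spectral (primary_linked rho_rep rho_indec sum_es esP e'es pe' ees pe).
(* Without such a constituent the condition on [chi] is vacuous, and [0] is a default. *)
by exists 0 => p M sigma sp sc; case: none; exists p, M, sigma.
Qed.
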